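(* Let $n$ be a positive integer. Then $$|\mathrm{wEnd}\,\vec{P}_n|=\sum_{k=1}^{n}(n-k+1)\binom{n-1}{k-1}.$$
   Context: $\vec{P}_n$ denotes the directed path with vertex set $\{1,\ldots,n\}$ and edge set $E=\{(i,i+1) : i=1,\ldots,n-1\}$. $\mathrm{wEnd}\,\vec{P}_n$ denotes the set of all weak endomorphisms of $\vec{P}_n$, i.e. the maps $\alpha:\{1,\ldots,n\}\to\{1,\ldots,n\}$ such that, for all vertices $u,v$, if $(u,v)\in E$ and $u\alpha\neq v\alpha$ then $(u\alpha,v\alpha)\in E$ (maps are written on the right of their arguments). *)

(* Defs.v *)
From mathcomp Require Import all_boot.

Set Implicit Arguments.
Unset Strict Implicit.
Unset Printing Implicit Defensive.

(* The vertex i : 'I_n stands for the vertex i + 1 of {1, ..., n}. *)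
Definition dipath (n : nat) : rel 'I_n := fun i j => j == i.+1 :> nat.

Definition wEnd (V : finType) (e : rel V) : {set {ffun V -> V}} :=
  [set a : {ffun V -> V} |
    [forall u, forall v, e u v && (a u != a v) ==> e (a u) (a v)]].

(* Main.v *)
Require Import Defs.
From mathcomp Require Import all_boot.

(** Along an edge of the directed path a weak endomorphism either stays put or
    moves up by exactly one vertex.  It is therefore determined by its value at
    the first vertex together with the set [S] of edges on which it moves, since
    its value at any vertex is the initial value plus the number of moves made so
    far ([wEnd_value]).  Conversely an initial value [s] and a set [S] of edges
    come from a weak endomorphism exactly when the walk does not overrun the
    path, that is, when its last value [s + #|S|] is still a vertex.  So
    [(S, s)] ranges over the set [fitting m] ([card_wEnd_fitting]).  For a fixed
    [S] there are [n - #|S|] admissible initial values, and there are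
    ['C(n - 1, j)] sets of [j] edges; summing over [j = k - 1] gives the
    formula. *)

Set Implicit Arguments.
Unset Strict Implicit.
Unset Printing Implicit Defensive.

(** * Sums over all subsets of an interval *)

Lemma sum_over_card m (F : nat -> nat) :
  \sum_(S : {set 'I_m}) F #|S| = \sum_(j < m.+1) F j * 'C(m, j).
Proof.
have leS (S : {set 'I_m}) : #|S| < m.+1.
  by rewrite ltnS -[leqRHS](card_ord m) max_card.
rewrite (partition_big (fun S => Ordinal (leS S)) predT) //=.
apply: eq_bigr => j _.
rewrite (eq_bigr (fun=> F j)); last by move=> S /eqP <-.
rewrite sum_nat_const mulnC; congr (_ * _).
transitivity #|[set S : {set 'I_m} | #|S| == j]|; last first.
  by rewrite card_draws card_ord.
by apply: eq_card => S; rewrite inE.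
Qed.

Lemma card_ord_lt n k : k <= n -> #|[pred i : 'I_n | i < k]| = k.
Proof.
move=> le_kn; rewrite -sum1_card -(big_ord_widen n (fun=> 1) le_kn).
by rewrite sum1_card card_ord.
Qed.

(** * Walks on the directed path *)

Section Walks.

Variable m : nat.

Implicit Types (S : {set 'I_m}) (s : 'I_m.+1) (a : {ffun 'I_m.+1 -> 'I_m.+1}).

(** The edge [j : 'I_m] joins the vertices [j] and [j.+1]. *)
Definition tail (j : 'I_m) : 'I_m.+1 := widen_ord (leqnSn m) j.
Definition head (j : 'I_m) : 'I_m.+1 := lift ord0 j.

Definition moves a : {set 'I_m} := [set j | a (tail j) != a (head j)].

Definition below S i := #|[set j in S | j < i]|.

(** Outside [fitting] the sum may overrun the path, where [inord] returns a
    default value. *)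
Definition walk (p : {set 'I_m} * 'I_m.+1) : {ffun 'I_m.+1 -> 'I_m.+1} :=
  [ffun i : 'I_m.+1 => inord (p.2 + below p.1 i)].

Definition fitting : {set {set 'I_m} * 'I_m.+1} :=
  [set p : {set 'I_m} * 'I_m.+1 | p.2 < m.+1 - #|p.1|].

Lemma below0 S : below S 0 = 0.
Proof. by apply: eq_card0 => j; rewrite !inE andbF. Qed.

Lemma belowS S (j : 'I_m) : below S j.+1 = (j \in S) + below S j.
Proof.
rewrite /below (cardsD1 j) !inE ltnS leqnn andbT; congr (_ + _).
apply: eq_card => k; rewrite !inE ltnS [k < j]ltn_neqAle -val_eqE /=.
by rewrite andbCA.
Qed.

Lemma below_le S i : below S i <= #|S|.
Proof. by apply: subset_leq_card; apply/subsetP=> j; rewrite inE => /andP[]. Qed.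

Lemma below_all S : below S m = #|S|.
Proof. by apply: eq_card => j; rewrite inE ltn_ord andbT. Qed.

Lemma wEnd_edgeP a :
  reflect (forall j, a (head j) = (j \in moves a) + a (tail j) :> nat)
          (a \in wEnd (@dipath m.+1)).
Proof.
rewrite inE; apply: (iffP forallP) => [wa j | step u].
  move/forallP: (wa (tail j)) => /(_ (head j)).
  rewrite /dipath /= eqxx inE /=.
  by case: eqVneq => [-> | _ /= /eqP].
apply/forallP=> v; apply/implyP=> /andP[/eqP uv neq].
have lt_um : u < m by rewrite -ltnS -uv.
have Eu : u = tail (Ordinal lt_um) by apply: val_inj.
have Ev : v = head (Ordinal lt_um) by apply: val_inj.
by rewrite /dipath Ev step inE -Ev -Eu neq.
Qed.

Lemma wEnd_value a i : a \in wEnd (@dipath m.+1) ->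
  a i = a ord0 + below (moves a) i :> nat.
Proof.
move=> /wEnd_edgeP step; case: i => i; elim: i => [|i IHi] lt_i.
  by rewrite below0 addn0; congr (val (a _)); apply: val_inj.
have lt_im : i < m by [].
have -> : Ordinal lt_i = head (Ordinal lt_im) by apply: val_inj.
rewrite step (belowS _ (Ordinal lt_im)) addnCA; congr (_ + _).
by rewrite -(IHi (ltnW lt_i)); congr (val (a _)); apply: val_inj.
Qed.

Lemma walk_value p i : p \in fitting -> walk p i = p.2 + below p.1 i :> nat.
Proof.
rewrite inE ltn_subRL addnC ffunE => fit; rewrite inordK //.
by apply: leq_ltn_trans fit; rewrite leq_add2l below_le.
Qed.

Lemma moves_walk p : p \in fitting -> moves (walk p) = p.1.
Proof.
move=> fit; apply/setP=> j; rewrite inE -val_eqE /= !walk_value //= belowS.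
by rewrite eqn_add2l; case: (j \in p.1); rewrite /= ?add0n ?eqxx // neq_ltn leqnn.
Qed.

Lemma walk_wEnd p : p \in fitting -> walk p \in wEnd (@dipath m.+1).
Proof.
move=> fit; apply/wEnd_edgeP=> j.
by rewrite moves_walk // !walk_value //= belowS addnCA.
Qed.

(** The inverse of [walk] reads off the moves and the initial value; the pair
    obtained is fitting because the image of the last vertex is a vertex. *)
Lemma card_wEnd_fitting : #|wEnd (@dipath m.+1)| = #|fitting|.
Proof.
have walk_inj : {in fitting &, injective walk}.
  move=> [S s] [T t] fitS fitT eqw.
  have eqST : S = T by rewrite -[S](moves_walk fitS) eqw moves_walk.
  congr (_, _) => //; apply: val_inj => /=.
  move: (walk_value ord0 fitS) (walk_value ord0 fitT).
  by rewrite eqw /= !below0 !addn0 => ->.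
rewrite -(card_in_imset walk_inj); congr #|pred_of_set _|.
apply/setP=> a; apply/idP/imsetP => [wa | [p fit ->]]; last exact: walk_wEnd.
have fit : (moves a, a ord0) \in fitting.
  by rewrite inE ltn_subRL addnC -below_all -(wEnd_value ord_max wa).
exists (moves a, a ord0) => //; apply/ffunP=> i; apply: val_inj => /=.
by rewrite walk_value //= wEnd_value.
Qed.

Lemma card_fitting : #|fitting| = \sum_(S : {set 'I_m}) (m.+1 - #|S|).
Proof.
rewrite -sum1_card.
rewrite (eq_bigl (fun p : {set 'I_m} * 'I_m.+1 => predT p.1 && (p.2 < m.+1 - #|p.1|)));
  last first.
  by move=> p; rewrite inE.
rewrite -(pair_big_dep predT (fun S (s : 'I_m.+1) => s < m.+1 - #|S|) (fun _ _ => 1)) /=.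
by apply: eq_bigr => S _; rewrite sum1_card card_ord_lt // leq_subr.
Qed.

End Walks.

Theorem theorem1p6 (n : nat) (hn : 0 < n) :
  #|wEnd (@dipath n)| = \sum_(1 <= k < n.+1) (n - k + 1) * 'C(n - 1, k - 1).
Proof.
case: n hn => // m _.
rewrite card_wEnd_fitting card_fitting (sum_over_card m (fun j => m.+1 - j)).
rewrite big_add1 /= big_mkord; apply: eq_bigr => j _.
by rewrite !subn1 /= subSS addn1 subSn // -ltnS.
Qed.
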